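(* Let $p\in\mathbb{C}[x]$ be a non-zero polynomial and let $\varepsilon=(-1)^{\deg p}$. There exists an anti-involution of $\mathcal{D}^a_p$ preserving the principal $\mathbb{Z}$-gradation if and only if there exists $c\in\mathbb{C}$ such that $p(x)=\varepsilon\,p(-x+c)$ (as polynomials in $x$). Moreover, suppose such a $c$ exists. (i) If $\deg p\ge 1$, then $c$ is unique, and there are exactly two anti-involutions of $\mathcal{D}^a_p$ preserving the principal $\mathbb{Z}$-gradation, namely $\sigma_+$ and $\sigma_-$ given by $$\sigma_{\pm}\big(t^kf(D)p(D)\big)=\varepsilon\,(\pm t)^k f(-D-k+c)\,p(D)\qquad (k\in\mathbb{Z},\ f\in\mathbb{C}[x]).$$ (ii) If $\deg p=0$, then $c\in\mathbb{C}$ is a free parameter, and the anti-involutions of $\mathcal{D}^a_p$ preserving the principal $\mathbb{Z}$-gradation are exactly the members of the two families $\sigma_{+}=\sigma_{+,c}$ and $\sigma_-=\sigma_{-,c}$, $c\in\mathbb{C}$, given by the same formula.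
   Context: $\mathcal{D}^a$ is the associative algebra of regular differential operators on the circle, i.e. operators on $\mathbb{C}[t,t^{-1}]$ of the form $e_k(t)\partial_t^k+\dots+e_0(t)$ with $e_i\in\mathbb{C}[t,t^{-1}]$. Put $D=t\partial_t$. Then $\{t^kD^l: k\in\mathbb{Z},\ l\in\mathbb{Z}_{\ge0}\}$ is a basis of $\mathcal{D}^a$, and $t^rf(D)\cdot t^sg(D)=t^{r+s}f(D+s)g(D)$ for $f,g\in\mathbb{C}[x]$. For $p\in\mathbb{C}[x]$, $\mathcal{D}^a_p:=\mathcal{D}^a p(D)$, an associative subalgebra of $\mathcal{D}^a$ (not necessarily containing $1$). Its principal $\mathbb{Z}$-gradation is $\mathcal{D}^a_p=\bigoplus_{j\in\mathbb{Z}}(\mathcal{D}^a_p)_j$ with $(\mathcal{D}^a_p)_j=\{t^jf(D)p(D): f\in\mathbb{C}[x]\}$. An anti-involution of $\mathcal{D}^a_p$ is a $\mathbb{C}$-linear map $\sigma:\mathcal{D}^a_p\to\mathcal{D}^a_p$ with $\sigma^2=\mathrm{Id}$ and $\sigma(XY)=\sigma(Y)\sigma(X)$ for all $X,Y$. It preserves the principal gradation if $\sigma((\mathcal{D}^a_p)_j)\subseteq(\mathcal{D}^a_p)_j$ for all $j$. The notation $(\pm t)^k$ means $(\pm1)^kt^k$. *)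

(* Defs.v *)
From HB Require Import structures.
From mathcomp Require Import all_boot all_order all_algebra finmap.
From mathcomp Require Import boolp reals complex.
From mathcomp.multinomials Require Import monalg.

Set Implicit Arguments.
Unset Strict Implicit.
Unset Printing Implicit Defensive.

Import GRing.Theory.
Local Open Scope fset_scope.
Local Open Scope ring_scope.

(* Laurent polynomials F[t, t^-1]: finitely supported families of           *)
(* coefficients indexed by int, where << a *g k >> stands for a t^k.        *)
(* monalg only gives {malg F[K]} a product when K is a conical monoid,      *)
(* which (int, +) is not, so the ring structure is built here.              *)
Definition laurent (F : fieldType) := {malg F[int]}.

Section LaurentAlgebra.
Variable F : fieldType.
Implicit Types (x y z : laurent F) (k l : int) (a b : F).

HB.instance Definition _ := GRing.Lmodule.on (laurent F).

Definition lmono a k : laurent F := << a *g k >>.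

Definition lmul x y : laurent F :=
  \sum_(k <- msupp x) \sum_(l <- msupp y) lmono (x@_k * y@_l) (k + l).

Definition lone : laurent F := lmono 1 0.

Lemma laurent_ind (P : laurent F -> Prop) :
  P 0 -> (forall x y, P x -> P y -> P (x + y)) ->
  (forall a k, P (lmono a k)) -> forall x, P x.
Proof.
move=> P0 PD PU x; rewrite [x]monalgE.
by elim/big_ind: _ => // k _; apply: PU.
Qed.

Lemma lmono0 k : lmono 0 k = 0.
Proof. exact: monalgU0. Qed.

Lemma lmonoD k : {morph lmono^~ k : a b / a + b}.
Proof. exact: monalgUD. Qed.

Lemma lmulw (d1 d2 : {fset int}) x y : msupp x `<=` d1 -> msupp y `<=` d2 ->
  lmul x y = \sum_(k <- d1) \sum_(l <- d2) lmono (x@_k * y@_l) (k + l).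
Proof.
move=> le1 le2; rewrite /lmul (big_fset_incl _ le1) /=.
  apply/eq_bigr=> k1 _; apply/big_fset_incl => // k _ /mcoeff_outdom ->.
  by rewrite mulr0 lmono0.
move=> k _ /mcoeff_outdom xk.
by rewrite big1 => // k' _; rewrite xk mul0r lmono0.
Qed.

Lemma lmulUU a b k l : lmul (lmono a k) (lmono b l) = lmono (a * b) (k + l).
Proof.
by rewrite (lmulw msuppU_le msuppU_le) !big_seq_fset1 !mcoeffUU.
Qed.

Lemma lmulC : commutative lmul.
Proof.
move=> x y; rewrite /lmul exchange_big; apply: eq_bigr => k _ /=.
by apply: eq_bigr => l _; rewrite mulrC addrC.
Qed.

Lemma lmulDl : left_distributive lmul +%R.
Proof.
move=> x y z.
rewrite (lmulw (msuppD_le x y) (fsubset_refl _)).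
rewrite (lmulw (fsubsetUl _ (msupp y)) (fsubset_refl (msupp z))).
rewrite (lmulw (fsubsetUr (msupp x) _) (fsubset_refl (msupp z))).
rewrite -big_split /=; apply/eq_bigr=> k1 _.
rewrite -big_split /=; apply/eq_bigr=> k2 _.
by rewrite mcoeffD mulrDl lmonoD.
Qed.

Lemma lmulDr : right_distributive lmul +%R.
Proof. by move=> x y z; rewrite lmulC lmulDl ![lmul _ x]lmulC. Qed.

Lemma lmul0x : left_zero 0 lmul.
Proof. by move=> x; rewrite /lmul msupp0 big_seq_fset0. Qed.

Lemma lmulx0 : right_zero 0 lmul.
Proof. by move=> x; rewrite lmulC lmul0x. Qed.

Lemma lmulA : associative lmul.
Proof.
elim/laurent_ind=> [|x1 x2 IH1 IH2|a k] y z.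
- by rewrite !lmul0x.
- by rewrite !lmulDl IH1 IH2.
elim/laurent_ind: y => [|y1 y2 IH1 IH2|b l].
- by rewrite lmul0x lmulx0 lmul0x.
- by rewrite lmulDl !lmulDr lmulDl IH1 IH2.
elim/laurent_ind: z => [|z1 z2 IH1 IH2|c m].
- by rewrite !lmulx0.
- by rewrite !lmulDr IH1 IH2.
by rewrite !lmulUU mulrA addrA.
Qed.

Lemma lmul1x : left_id lone lmul.
Proof.
elim/laurent_ind=> [|y z IHy IHz|a k].
- by rewrite lmulx0.
- by rewrite lmulDr IHy IHz.
by rewrite lmulUU mul1r add0r.
Qed.

Lemma lone_neq0 : lone != 0.
Proof. by rewrite monalgU_eq0 oner_eq0. Qed.

HB.instance Definition _ := GRing.Zmodule_isComNzRing.Build (laurent F)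
  lmulA lmulC lmul1x lmulDl lone_neq0.

Lemma lmonoM a b k l : lmono a k * lmono b l = lmono (a * b) (k + l).
Proof. exact: lmulUU. Qed.

Lemma lmonoZ c a k : c *: lmono a k = lmono (c * a) k.
Proof.
by apply/malgP=> j; rewrite mcoeffZ !mcoeffU mulrnAr.
Qed.

Lemma laurent_scaleAl c x y : c *: (x * y) = (c *: x) * y.
Proof.
elim/laurent_ind: x => [|x1 x2 IH1 IH2|a k].
- by rewrite !(mul0r, scaler0).
- by rewrite scalerDr !mulrDl scalerDr IH1 IH2.
elim/laurent_ind: y => [|y1 y2 IH1 IH2|b l].
- by rewrite !(mulr0, scaler0).
- by rewrite !mulrDr scalerDr IH1 IH2.
by rewrite lmonoZ !lmonoM lmonoZ mulrA.
Qed.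

HB.instance Definition _ :=
  GRing.Lmodule_isLalgebra.Build F (laurent F) laurent_scaleAl.
HB.instance Definition _ := GRing.Lalgebra_isComAlgebra.Build F (laurent F).

Definition lderiv x : laurent F :=
  \sum_(k <- msupp x) lmono (k%:~R * x@_k) (k - 1).

Lemma lderivE x k : (lderiv x)@_k = (k + 1)%:~R * x@_(k + 1).
Proof.
rewrite {2}[x]monalgE !raddf_sum mulr_sumr.
apply: eq_bigr => /= l _; rewrite !mcoeffU subr_eq.
by have [->|_] := eqVneq; rewrite ?mulr1n ?mulr0n ?mulr0.
Qed.

Lemma lderiv_is_linear : linear lderiv.
Proof.
move=> c x y; apply/malgP=> k.
by rewrite mcoeffD mcoeffZ !lderivE mcoeffD mcoeffZ mulrDr mulrCA.
Qed.

HB.instance Definition _ :=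
  GRing.isLinear.Build F (laurent F) (laurent F) *:%R lderiv lderiv_is_linear.

Lemma lderivU a k : lderiv (lmono a k) = lmono (k%:~R * a) (k - 1).
Proof.
apply/malgP=> j; rewrite lderivE !mcoeffU subr_eq.
by have [->|_] := eqVneq; rewrite ?mulr1n ?mulr0n ?mulr0.
Qed.

Lemma lderivM x y : lderiv (x * y) = lderiv x * y + x * lderiv y.
Proof.
elim/laurent_ind: x => [|x1 x2 IH1 IH2|a k].
- by rewrite !(mul0r, linear0) addr0.
- by rewrite mulrDl !linearD /= !mulrDl IH1 IH2 addrACA.
elim/laurent_ind: y => [|y1 y2 IH1 IH2|b l].
- by rewrite !(mulr0, linear0) addr0.
- by rewrite mulrDr !linearD /= !mulrDr IH1 IH2 addrACA.
rewrite lmonoM !lderivU !lmonoM addrA addrAC -lmonoD; congr lmono.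
by rewrite rmorphD mulrDl -mulrA [a * (_ * _)]mulrCA.
Qed.

End LaurentAlgebra.

(* The algebra of F-linear endomorphisms of F[t, t^-1], with composition as *)
(* product.                                                                 *)
Definition endo (F : fieldType) := {linear laurent F -> laurent F}.

Section EndoAlgebra.
Variable F : fieldType.
Implicit Types A B : endo F.

HB.instance Definition _ := gen_eqMixin (endo F).
HB.instance Definition _ := gen_choiceMixin (endo F).

Lemma endoP A B : A =1 B <-> A = B.
Proof.
split=> [eqAB|-> //]; move: A B eqAB => [f [[f1] [f2]]] [g [[g1] [g2]]] /=.
move/funext => eqfg; move: f1 f2; rewrite /= eqfg => f1 f2.
by rewrite (Prop_irrelevance f1 g1) (Prop_irrelevance f2 g2).
Qed.

Definition endo_zero : endo F := \0.
Definition endo_opp A : endo F := \- A.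
Definition endo_add A B : endo F := A \+ B.
Definition endo_scale (c : F) A : endo F := c \*: A.
Definition endo_one : endo F := idfun.
Definition endo_mul A B : endo F := A \o B.

Lemma endo_addA : associative endo_add.
Proof. by move=> A B E; apply/endoP=> x /=; rewrite addrA. Qed.
Lemma endo_addC : commutative endo_add.
Proof. by move=> A B; apply/endoP=> x /=; rewrite addrC. Qed.
Lemma endo_add0 : left_id endo_zero endo_add.
Proof. by move=> A; apply/endoP=> x /=; rewrite add0r. Qed.
Lemma endo_addN : left_inverse endo_zero endo_opp endo_add.
Proof. by move=> A; apply/endoP=> x /=; rewrite addNr. Qed.
HB.instance Definition _ := GRing.isZmodule.Build (endo F)
  endo_addA endo_addC endo_add0 endo_addN.

Lemma endo_mulA : associative endo_mul.
Proof. by move=> A B E; apply/endoP. Qed.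
Lemma endo_mul1l : left_id endo_one endo_mul.
Proof. by move=> A; apply/endoP. Qed.
Lemma endo_mul1r : right_id endo_one endo_mul.
Proof. by move=> A; apply/endoP. Qed.
Lemma endo_mulDl : left_distributive endo_mul +%R.
Proof. by move=> A B E; apply/endoP. Qed.
Lemma endo_mulDr : right_distributive endo_mul +%R.
Proof. by move=> A B E; apply/endoP=> x /=; rewrite linearD. Qed.
Lemma endo_one_neq0 : endo_one != 0.
Proof.
apply/eqP => /endoP/(_ 1) /= /eqP; apply/negP; exact: oner_neq0.
Qed.
HB.instance Definition _ := GRing.Zmodule_isNzRing.Build (endo F)
  endo_mulA endo_mul1l endo_mul1r endo_mulDl endo_mulDr endo_one_neq0.

Lemma endo_scaleA a b A : endo_scale a (endo_scale b A) = endo_scale (a * b) A.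
Proof. by apply/endoP=> x /=; rewrite scalerA. Qed.
Lemma endo_scale1 : left_id 1 endo_scale.
Proof. by move=> A; apply/endoP=> x /=; rewrite scale1r. Qed.
Lemma endo_scaleDr : right_distributive endo_scale +%R.
Proof. by move=> a A B; apply/endoP=> x /=; rewrite scalerDr. Qed.
Lemma endo_scaleDl A : {morph endo_scale^~ A : a b / a + b}.
Proof. by move=> a b; apply/endoP=> x /=; rewrite scalerDl. Qed.
HB.instance Definition _ := GRing.Zmodule_isLmodule.Build F (endo F)
  endo_scaleA endo_scale1 endo_scaleDr endo_scaleDl.

Lemma endo_scaleAl a A B : a *: (A * B) = a *: A * B.
Proof. by apply/endoP. Qed.
HB.instance Definition _ :=
  GRing.Lmodule_isLalgebra.Build F (endo F) endo_scaleAl.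
Lemma endo_scaleAr a A B : a *: (A * B) = A * (a *: B).
Proof. by apply/endoP=> x /=; rewrite linearZ. Qed.
HB.instance Definition _ :=
  GRing.Lalgebra_isAlgebra.Build F (endo F) endo_scaleAr.

End EndoAlgebra.

Section DiffOps.
Variable F : fieldType.
Implicit Types (A B : endo F) (e : laurent F) (f p : {poly F}).

Definition mulop e : endo F := e \*o idfun.
Definition dt : endo F := @lderiv F.
Definition tpow (k : int) : endo F := mulop (lmono 1 k).
Definition opD : endo F := tpow 1 * dt.

Lemma mulopD : {morph mulop : e1 e2 / e1 + e2}.
Proof. by move=> e1 e2; apply/endoP=> x /=; rewrite mulrDl. Qed.

Lemma mulopM : {morph mulop : e1 e2 / e1 * e2}.
Proof. by move=> e1 e2; apply/endoP=> x /=; rewrite mulrA. Qed.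

Lemma mulop1 : mulop 1 = 1.
Proof. by apply/endoP=> x /=; rewrite mul1r. Qed.

Lemma mulopZ c e : mulop (c *: e) = c *: mulop e.
Proof. by apply/endoP=> x /=; rewrite scalerAl. Qed.

Lemma dt_mulop e : dt * mulop e = mulop (lderiv e) + mulop e * dt.
Proof. by apply/endoP=> x /=; rewrite lderivM. Qed.

(* The algebra D^a of regular differential operators on the circle. *)
Definition diffop : {pred endo F} := fun A =>
  `[< exists (n : nat) (e : nat -> laurent F),
        A = \sum_(i < n.+1) mulop (e i) * dt ^+ i >].

Lemma diffopP A : reflect
  (exists (n : nat) (e : nat -> laurent F),
     A = \sum_(i < n.+1) mulop (e i) * dt ^+ i) (A \in diffop).
Proof. exact: asboolP. Qed.

Lemma mulop0 : mulop 0 = 0.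
Proof. by apply/endoP=> x /=; rewrite mul0r. Qed.

Lemma diffop_term e i : mulop e * dt ^+ i \in diffop.
Proof.
apply/diffopP; exists i, (fun j => if j == i then e else 0).
rewrite big_ord_recr /= eqxx big1 ?add0r // => j _.
by rewrite (ltn_eqF (ltn_ord j)) mulop0 mul0r.
Qed.

Lemma diffop_pad n m (e : nat -> laurent F) : (n <= m)%N ->
  \sum_(i < n.+1) mulop (e i) * dt ^+ i =
  \sum_(i < m.+1) mulop (if (i < n.+1)%N then e i else 0) * dt ^+ i.
Proof.
move=> le_nm; rewrite (big_ord_widen _ (fun i => mulop (e i) * dt ^+ i) (_ : n.+1 <= m.+1)%N) //.
rewrite big_mkcond; apply: eq_bigr => i _.
by case: ifP => // _; rewrite mulop0 mul0r.
Qed.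

Lemma diffop_add A B : A \in diffop -> B \in diffop -> A + B \in diffop.
Proof.
move=> /diffopP[n [e ->]] /diffopP[m [g ->]]; apply/diffopP.
exists (maxn n m); rewrite (diffop_pad e (leq_maxl n m)).
rewrite (diffop_pad g (leq_maxr n m)) -big_split /=.
exists (fun i => (if (i < n.+1)%N then e i else 0)
               + (if (i < m.+1)%N then g i else 0)).
by apply: eq_bigr => i _; rewrite mulopD mulrDl.
Qed.

Lemma diffop_sum (I : Type) (r : seq I) (E : I -> endo F) :
  (forall i, E i \in diffop) -> \sum_(i <- r) E i \in diffop.
Proof.
move=> dE; elim/big_ind: _ => //; last exact: diffop_add.
by rewrite -(mul0r (dt ^+ 0)) -mulop0 diffop_term.
Qed.

Lemma diffop_mull e A : A \in diffop -> mulop e * A \in diffop.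
Proof.
move=> /diffopP[n [g ->]]; rewrite mulr_sumr; apply: diffop_sum => i.
by rewrite mulrA -mulopM diffop_term.
Qed.

Lemma diffop_dtl i A : A \in diffop -> dt ^+ i * A \in diffop.
Proof.
elim: i => [|i IH] dA; first by rewrite expr0 mul1r.
rewrite exprS -mulrA; move: (IH dA) => /diffopP[n [g ->]].
rewrite mulr_sumr; apply: diffop_sum => j.
by rewrite mulrA dt_mulop mulrDl diffop_add // -?mulrA -?exprS diffop_term.
Qed.

Lemma diffop_subalg_closed : subalg_closed diffop.
Proof.
split=> [|c A B dA dB|A B].
- by rewrite -[1]mul1r -{1}mulop1 -(expr0 dt) diffop_term.
- rewrite diffop_add // -[A]mul1r scalerAl -mulop1 -mulopZ.
  exact: diffop_mull.
move=> /diffopP[n [g ->]] dB; rewrite mulr_suml; apply: diffop_sum => i.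
by rewrite -mulrA; apply/diffop_mull/diffop_dtl.
Qed.

HB.instance Definition _ :=
  GRing.isSubalgClosed.Build F (endo F) diffop diffop_subalg_closed.

Lemma tpow_diffop k : tpow k \in diffop.
Proof. by rewrite -[tpow k]mulr1 -(expr0 dt) diffop_term. Qed.

Lemma opD_diffop : opD \in diffop.
Proof. by rewrite /opD -[dt]expr1 diffop_term. Qed.

Lemma horner_opD_diffop f : horner_alg opD f \in diffop.
Proof.
elim/poly_ind: f => [|f c IH]; first by rewrite linear0 rpred0.
rewrite rmorphD rmorphM /= horner_algX horner_algC.
apply: rpredD; first by rewrite rpredM ?opD_diffop.
by apply: rpredZ; apply: rpred1.
Qed.

(* D^a_p = D^a p(D). *)
Definition dap_pred p : {pred endo F} := fun X =>
  `[< exists2 A, A \in diffop & X = A * horner_alg opD p >].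

Lemma dap_predP p X : reflect
  (exists2 A, A \in diffop & X = A * horner_alg opD p) (X \in dap_pred p).
Proof. exact: asboolP. Qed.

Lemma dap_submod_closed p : submod_closed (dap_pred p).
Proof.
split=> [|c X Y /dap_predP[A dA ->] /dap_predP[B dB ->]]; apply/dap_predP.
  by exists 0; rewrite ?rpred0 ?mul0r.
exists (c *: A + B); last by rewrite mulrDl scalerAl.
by rewrite rpredD ?rpredZ.
Qed.

HB.instance Definition _ p :=
  GRing.isSubmodClosed.Build F (endo F) (dap_pred p) (dap_submod_closed p).

Record dap p := Dap { dap_val : endo F; _ : dap_val \in dap_pred p }.

HB.instance Definition _ p := [isSub for @dap_val p].
HB.instance Definition _ p := [Choice of dap p by <:].
HB.instance Definition _ p := [SubChoice_isSubLmodule of dap p by <:].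

Lemma dap_mul_subproof p (X Y : dap p) : val X * val Y \in dap_pred p.
Proof.
case: X Y => [X dX] [Y dY] /=.
move: dX dY => /dap_predP[A dA ->] /dap_predP[B dB ->]; apply/dap_predP.
exists (A * horner_alg opD p * B); last by rewrite !mulrA.
by rewrite !rpredM ?horner_opD_diffop.
Qed.

Definition dap_mul p (X Y : dap p) : dap p := Dap (dap_mul_subproof X Y).

Lemma dap_mon_subproof p k f :
  tpow k * horner_alg opD f * horner_alg opD p \in dap_pred p.
Proof.
apply/dap_predP; exists (tpow k * horner_alg opD f) => //.
by rewrite rpredM ?tpow_diffop ?horner_opD_diffop.
Qed.

(* t^k f(D) p(D) *)
Definition dap_mon p k f : dap p := Dap (dap_mon_subproof p k f).

Definition dap_gr p (j : int) (X : dap p) : Prop := exists f, X = dap_mon p j f.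

Record graded_anti_involution p (s : dap p -> dap p) : Prop := {
  gai_linear : linear s;
  gai_invol : involutive s;
  gai_antimul : forall X Y, s (dap_mul X Y) = dap_mul (s Y) (s X);
  gai_graded : forall j X, dap_gr j X -> dap_gr j (s X)
}.

Definition deg p : nat := (size p).-1.

Definition eps p : F := (-1) ^+ deg p.

Definition p_sym p (c : F) : Prop := p = eps p *: (p \Po (c%:P - 'X)).

(* s (t^k f(D) p(D)) = eps (u t)^k f(- D - k + c) p(D), where u is 1 or -1 *)
Definition sigma_formula p (u c : F) (s : dap p -> dap p) : Prop :=
  forall k f, s (dap_mon p k f) =
    (eps p * u ^ k) *: dap_mon p k (f \Po (- 'X - (k%:~R)%:P + c%:P)).

End DiffOps.

(* Main.v *)
(* Writing (k, f) for t^k f(D) p(D), one has                                  *)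
(*   (k, f) (l, g) = (k + l, f(x + l) p(x + l) g(x)),                         *)
(* so a graded anti-involution is a family of linear involutions S_k of F[x]  *)
(* with S_(k+l) (f(x+l) p(x+l) g) = S_l(g)(x+k) p(x+k) S_k(f).  For k = l = 0 *)
(* this gives S_0(f) S_0(g) = S_0(fg) S_0(1); as S_0 is an involution, S_0(1) *)
(* is a constant a with a^2 = 1, hence S_0(f) = a f(T) where T o T = x and    *)
(* p = a p(T).  So T = x or T = c - x.  The first is impossible: comparing    *)
(* (k, l) = (0, 1) and (1, 0) gives f p = (f p)(x + 2) for all f.  In the     *)
(* second, leading coefficients give a = eps, and the cases where k or l is 0 *)
(* force S_k(f) = b_k f(-x - k + c) with constants b_k = +-1.  The general    *)
(* case says that k |-> eps b_k is a homomorphism, so it is k |-> u^k.        *)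

Require Import Defs.
From mathcomp Require Import all_boot all_order all_algebra ring.
From mathcomp.multinomials Require Import monalg.
From mathcomp Require Import boolp reals complex.

Import GRing.Theory Num.Theory.
Local Open Scope ring_scope.

Set Implicit Arguments.
Unset Strict Implicit.

(** The operator t^k f(D) p(D) sends t^m to f(m) p(m) t^(m + k). As p is nonzero and a polynomial is
    determined by its values at integers, elements of D^a p(D) have well-defined coefficients
    ([dap_coef_inj], [dap_mon_inj]), and laws in the algebra become polynomial identities.
    [gai_components] makes this translation; [S0_refl] and [components_form] solve the resulting
    equations as outlined above. Conversely, [sigma_gai] shows that the symmetry of p makes the
    reflected formula reverse products. Two symmetries with distinct c would compose to a
    translation fixing p, so c is unique unless p is constant ([p_sym_uniq]). *)

Lemma poly_ext_nat (F : numFieldType) (f g : {poly F}) :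
  (forall n : nat, f.[n%:R] = g.[n%:R]) -> f = g.
Proof.
move=> eq_fg; apply/eqP; rewrite -subr_eq0; apply/negPn/negP => nz.
pose rs := [seq n%:R : F | n <- iota 0 (size (f - g))].
have: (size rs < size (f - g)%R)%N.
  apply: max_poly_roots => //.
    by apply/allP => _ /mapP[n _ ->]; rewrite rootE !hornerE eq_fg subrr.
  by rewrite map_inj_uniq ?iota_uniq //; apply: mulrIn; rewrite oner_neq0.
by rewrite size_map size_iota ltnn.
Qed.

Lemma poly_ext_int (F : numFieldType) (f g : {poly F}) :
  (forall m : int, f.[m%:~R] = g.[m%:~R]) -> f = g.
Proof. by move=> eq_fg; apply: poly_ext_nat => n; apply: (eq_fg n%:Z). Qed.

Lemma poly_ext (F : numFieldType) (f g : {poly F}) :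
  (forall x, f.[x] = g.[x]) -> f = g.
Proof. by move=> eq_fg; apply: poly_ext_nat. Qed.

(** * Normal forms t^k f(D) and coefficients in D^a p(D) *)

Section Monomials.
Context {F : numFieldType}.
Implicit Types (f g p : {poly F}) (k m : int).

Definition shift k f := f \Po ('X + (k%:~R)%:P).

Lemma horner_shift k f x : (shift k f).[x] = f.[x + k%:~R].
Proof. by rewrite /shift horner_comp !hornerE. Qed.

Lemma opD_lmono (a : F) m : opD F (lmono a m) = m%:~R *: lmono a m.
Proof. by rewrite /opD /= lderivU lmonoM lmonoZ mul1r addrC subrK. Qed.

Lemma horner_opDZ (a : F) f :
  horner_alg (opD F) (a *: f) = a *: horner_alg (opD F) f.
Proof. by rewrite -mul_polyC rmorphM /= horner_algC mulr_algl. Qed.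

Lemma horner_opD_lmono f (a : F) m :
  horner_alg (opD F) f (lmono a m) = lmono (f.[m%:~R] * a) m.
Proof.
elim/poly_ind: f a => [|f c IH] a; first by rewrite linear0 horner0 mul0r lmono0.
rewrite rmorphD rmorphM /= horner_algX horner_algC !hornerE /=.
rewrite -[lmono 1 1 * _]/(opD F (lmono a m)) opD_lmono !lmonoZ IH -lmonoD.
by rewrite mulrDl mulrA.
Qed.

Lemma endo_ext (A B : endo F) :
  (forall m, A (lmono 1 m) = B (lmono 1 m)) -> A = B.
Proof.
move=> eqAB; apply/endoP; elim/laurent_ind=> [|x y IHx IHy|a k].
- by rewrite !linear0.
- by rewrite !linearD IHx IHy.
by rewrite -[a]mulr1 -lmonoZ !linearZ /= eqAB.
Qed.

Lemma tpow_hornerE k f m :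
  (tpow F k * horner_alg (opD F) f) (lmono 1 m) = lmono f.[m%:~R] (m + k).
Proof. by rewrite /= horner_opD_lmono lmonoM mul1r mulr1 addrC. Qed.

Lemma horner_opD_tpow k f :
  horner_alg (opD F) f * tpow F k = tpow F k * horner_alg (opD F) (shift k f).
Proof.
apply: endo_ext => m; rewrite tpow_hornerE /= lmonoM mul1r horner_opD_lmono.
by rewrite horner_shift mulr1 [k + m]addrC intrD.
Qed.

Lemma tpowD k l : tpow F (k + l) = tpow F k * tpow F l.
Proof. by rewrite /tpow -mulopM lmonoM mulr1. Qed.

(** The derivation is t^-1 D, and powers of t move left past polynomials in D at the cost of a
    shift. *)
Lemma dt_expE n : exists f, dt F ^+ n = tpow F (- n%:Z) * horner_alg (opD F) f.
Proof.
elim: n => [|n [f IH]]; first by exists 1; rewrite rmorph1 mulr1 /tpow mulop1.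
exists (shift (- n%:Z) 'X * f); rewrite exprS IH.
have -> : dt F = tpow F (-1) * horner_alg (opD F) 'X.
  rewrite horner_algX /opD mulrA -tpowD addNr.
  by rewrite /tpow mulop1 mul1r.
rewrite mulrA -[X in X * _ = _]mulrA horner_opD_tpow rmorphM !mulrA -tpowD.
by rewrite -opprD -intS.
Qed.

Lemma diffop_ind (P : endo F -> Prop) :
  (forall A B, P A -> P B -> P (A + B)) ->
  (forall k f, P (tpow F k * horner_alg (opD F) f)) ->
  forall A, A \in @diffop F -> P A.
Proof.
move=> PD PM _ /diffopP[n [e ->]].
have P0 : P 0 by have := PM 0 0; rewrite rmorph0 mulr0.
elim/big_ind: _ => // i _; have [f ->] := dt_expE i.
elim/laurent_ind: (e i) => [|x y IHx IHy|a k].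
- by rewrite mulop0 mul0r.
- by rewrite mulopD mulrDl; apply: PD.
suff -> : mulop (lmono a k) * (tpow F (- i%:Z) * horner_alg (opD F) f)
   = tpow F (k - i%:Z) * horner_alg (opD F) (a *: f) by apply: PM.
rewrite horner_opDZ -scalerAr scalerAl tpowD -[a in LHS]mulr1 -lmonoZ mulopZ.
by rewrite !scalerAl mulrA.
Qed.

Lemma dap_ind p (P : dap p -> Prop) :
  (forall X Y, P X -> P Y -> P (X + Y)) -> (forall k f, P (dap_mon p k f)) ->
  forall X, P X.
Proof.
move=> PD PM [X dX]; have /dap_predP[A dA eX] := dX.
(* Induction runs on the left factor [A], so membership proofs are kept out of the statement. *)
suff [Y PY eY] : exists2 Y, P Y & val Y = A * horner_alg (opD F) p.
  by rewrite (_ : Dap dX = Y) //; apply/val_inj; rewrite eY.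
elim/diffop_ind: A / dA {eX} => [A B [Y PY eY] [Z PZ eZ]|k f].
  by exists (Y + Z); [apply: PD | rewrite raddfD /= mulrDl -eY -eZ].
by exists (dap_mon p k f).
Qed.

Lemma val_dap_monE p k f m :
  val (dap_mon p k f) (lmono 1 m) = lmono (f.[m%:~R] * p.[m%:~R]) (m + k).
Proof. by rewrite /= horner_opD_lmono horner_opD_lmono lmonoM mul1r mulr1 addrC. Qed.

Lemma dap_mon_linear p k : linear (dap_mon p k).
Proof.
move=> a f g; apply/val_inj; rewrite [RHS]linearP /= rmorphD /= horner_opDZ.
by rewrite mulrDr mulrDl -scalerAr -scalerAl.
Qed.

Lemma dap_mulDl p (X Y Z : dap p) : dap_mul (X + Y) Z = dap_mul X Z + dap_mul Y Z.
Proof. by apply/val_inj; rewrite [RHS]raddfD /= -mulrDl. Qed.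

Lemma dap_mulDr p (X Y Z : dap p) : dap_mul X (Y + Z) = dap_mul X Y + dap_mul X Z.
Proof. by apply/val_inj; rewrite [RHS]raddfD /= -mulrDr. Qed.

Lemma dap_mul_mon p k l f g :
  dap_mul (dap_mon p k f) (dap_mon p l g) =
  dap_mon p (k + l) (shift l (f * p) * g).
Proof.
apply/val_inj; rewrite /= !mulrA; congr (_ * _).
rewrite -[X in X * tpow F l](mulrA (tpow F k)) -rmorphM.
by rewrite -[X in X * _ = _]mulrA horner_opD_tpow !rmorphM tpowD !mulrA.
Qed.

Lemma dap_val_linearE p a (X Y : dap p) x :
  val (a *: X + Y) x = a *: val X x + val Y x.
Proof.
by have -> : val (a *: X + Y) = a *: val X + val Y by exact: linearP.
Qed.

(* [f] is the coefficient of t^k in X: t^k f(D) p(D) maps t^m to              *)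
(* f(m) p(m) t^(m + k).                                                       *)
Lemma dap_coef_ex p (X : dap p) k : exists f, forall m,
  (val X (lmono 1 m))@_(m + k) = f.[m%:~R] * p.[m%:~R].
Proof.
elim/dap_ind: X => [X Y [f fP] [g gP]|l f].
  exists (f + g) => m; rewrite -[X]scale1r dap_val_linearE scale1r mcoeffD.
  by rewrite fP gP hornerD mulrDl.
exists (if l == k then f else 0) => m; rewrite val_dap_monE mcoeffU.
rewrite (can_eq (addKr m)).
by case: ifP => _; rewrite ?mulr1n // horner0 mul0r.
Qed.

(** A choice of coefficient; for nonzero p it is the only one, by [dap_coefP]. *)
Definition dap_coef p (X : dap p) k : {poly F} := sval (cid (dap_coef_ex X k)).

Section Coef.
Variable p : {poly F}.
Hypothesis p_neq0 : p != 0.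
Implicit Types X Y : dap p.

Lemma dap_coefP X k f :
  (forall m, (val X (lmono 1 m))@_(m + k) = f.[m%:~R] * p.[m%:~R]) ->
  dap_coef X k = f.
Proof.
move=> fP; apply: (mulIf p_neq0); apply: poly_ext_int => m.
by rewrite !hornerM -fP /dap_coef; case: cid.
Qed.

Lemma dap_coefE X k m :
  (val X (lmono 1 m))@_(m + k) = (dap_coef X k).[m%:~R] * p.[m%:~R].
Proof. by rewrite /dap_coef; case: cid. Qed.

Lemma dap_coef_inj X Y : (forall k, dap_coef X k = dap_coef Y k) -> X = Y.
Proof.
move=> eqXY; apply/val_inj/endo_ext => m; apply/malgP => n.
by rewrite -(subrK m n) addrC !dap_coefE eqXY.
Qed.

Lemma dap_coef_linear k : linear (fun X : dap p => dap_coef X k).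
Proof.
move=> a X Y; apply: dap_coefP => m.
rewrite dap_val_linearE mcoeffD mcoeffZ.
by rewrite !dap_coefE hornerD hornerZ mulrDl mulrA.
Qed.

Lemma dap_coef_mon k l f : dap_coef (dap_mon p k f) l = if k == l then f else 0.
Proof.
apply: dap_coefP => m; rewrite val_dap_monE mcoeffU (can_eq (addKr m)).
by case: ifP => _; rewrite ?mulr1n // horner0 mul0r.
Qed.

Lemma dap_mon_inj k : injective (dap_mon p k).
Proof.
by move=> f g /(congr1 (fun X : dap p => dap_coef X k)); rewrite !dap_coef_mon eqxx.
Qed.

End Coef.
End Monomials.

Lemma linear_funD (K : pzRingType) (U V : lmodType K) (s : U -> V) :
  linear s -> {morph s : x y / x + y}.
Proof. by move=> lin x y; rewrite -[x]scale1r lin !scale1r. Qed.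

Lemma linear_funZ (K : pzRingType) (U V : lmodType K) (s : U -> V) :
  linear s -> scalable s.
Proof.
move=> lin a x; have s0 : s 0 = 0.
  by apply: (addrI (s 0)); rewrite -linear_funD // !addr0.
by rewrite -[a *: x]addr0 lin s0 addr0.
Qed.

(** * The maps sigma: existence and anti-involution laws *)

Section AntiInvolutions.
Context {F : numFieldType}.
Variable p : {poly F}.
Hypothesis p_neq0 : p != 0.
Implicit Types (f g : {poly F}) (k l : int) (u c : F) (s : dap p -> dap p).

Lemma eps_sqr : eps p * eps p = 1.
Proof. by rewrite /eps -exprMn mulrNN mulr1 expr1n. Qed.

Lemma eps_neq0 : eps p != 0.
Proof. by rewrite /eps signr_eq0. Qed.

Lemma p_symE c x : p_sym p c -> p.[x] = eps p * p.[c - x].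
Proof. by move=> sym; rewrite {1}sym hornerZ horner_comp !hornerE. Qed.

Lemma horner_refl f k c x :
  (f \Po (- 'X - (k%:~R)%:P + c%:P)).[x] = f.[- x - k%:~R + c].
Proof. by rewrite horner_comp !hornerE. Qed.

(* The image is specified through its coefficients, which makes linearity and *)
(* the anti-involution laws checkable without finite sums.                    *)
Lemma sigma_coef_ex u c : exists s, forall X k, dap_coef (s X) k =
  (eps p * u ^ k) *: (dap_coef X k \Po (- 'X - (k%:~R)%:P + c%:P)).
Proof.
suff /boolp.choice[s sP] : forall X : dap p, exists Y : dap p, forall k, dap_coef Y k =
  (eps p * u ^ k) *: (dap_coef X k \Po (- 'X - (k%:~R)%:P + c%:P)) by exists s.
elim/(@dap_ind F p) => [X1 X2 [Y1 Y1P] [Y2 Y2P]|k f].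
  exists (Y1 + Y2) => k.
  rewrite !(linear_funD (dap_coef_linear p_neq0 k)) Y1P Y2P.
  by rewrite raddfD scalerDr.
exists (dap_mon p k ((eps p * u ^ k) *: (f \Po (- 'X - (k%:~R)%:P + c%:P)))) => l.
rewrite !dap_coef_mon //; case: eqP => [->//|_].
by rewrite raddf0 scaler0.
Qed.

Lemma sigma_formula_ex u c : exists s, linear s /\ sigma_formula u c s.
Proof.
have [s sP] := sigma_coef_ex u c; exists s; split=> [a X Y|k f].
  apply: dap_coef_inj => // k.
  rewrite (dap_coef_linear p_neq0 k) !sP (dap_coef_linear p_neq0 k).
  by rewrite raddfD /= linearZ /= scalerDr !scalerA mulrC.
apply: dap_coef_inj => // l; rewrite sP.
rewrite (linear_funZ (dap_coef_linear p_neq0 l)) !dap_coef_mon //.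
by case: eqP => [->//|_]; rewrite raddf0 !scaler0.
Qed.

Lemma eq_sigma u c s1 s2 : linear s1 -> linear s2 ->
  sigma_formula u c s1 -> sigma_formula u c s2 -> s1 = s2.
Proof.
move=> lin1 lin2 eq1 eq2; apply/funext; elim/(@dap_ind F p) => [X Y IHX IHY|k f].
  by rewrite !linear_funD // IHX IHY.
by rewrite eq1 eq2.
Qed.

(** All laws reduce to monomials. Reflections x -> -x - k + c are involutive, and for products both
    sides agree once p(x + k) is replaced by eps p(-x - k + c). *)
Lemma sigma_gai u c s : u * u = 1 -> p_sym p c ->
  linear s -> sigma_formula u c s -> graded_anti_involution s.
Proof.
move=> uu sym lin sP; have sD := linear_funD lin; have sZ := linear_funZ lin.
have monZ k := linear_funZ (dap_mon_linear p k).
have uu_k k : u ^ k * u ^ k = 1 by rewrite -expfzMl uu exp1rz.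
have u0 : u != 0 by apply: contra_eq_neq uu => ->; rewrite mul0r eq_sym oner_neq0.
split=> //.
- elim/(@dap_ind F p) => [X Y IHX IHY|k f]; first by rewrite !sD IHX IHY.
  rewrite sP sZ sP scalerA mulrACA eps_sqr uu_k mulr1 scale1r.
  by congr dap_mon; apply: poly_ext => x; rewrite !horner_refl; congr _.[_]; ring.
- elim/(@dap_ind F p) => [X1 X2 IH1 IH2|k f] Y.
    by rewrite dap_mulDl !sD IH1 IH2 dap_mulDr.
  elim/(@dap_ind F p): Y => [Y1 Y2 IH1 IH2|l g].
    by rewrite dap_mulDr !sD IH1 IH2 dap_mulDl.
  rewrite dap_mul_mon !sP -!monZ dap_mul_mon [l + k]addrC; congr dap_mon.
  apply: poly_ext => x; rewrite !(hornerZ, hornerM, horner_refl, horner_shift).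
  rewrite [p.[x + _]](p_symE _ sym) expfzDr // intrD.
  rewrite (_ : - x - (k%:~R + l%:~R) + c + l%:~R = - x - k%:~R + c); last by ring.
  rewrite (_ : - (x + k%:~R) - l%:~R + c = - x - (k%:~R + l%:~R) + c); last by ring.
  rewrite (_ : c - (x + k%:~R) = - x - k%:~R + c); last by ring.
  ring: eps_sqr.
by move=> j X [f ->]; rewrite sP -monZ; eexists.
Qed.

(** * Symmetries of p and substitutions in F[x] *)

Lemma p_sym_uniq c c' : (1 <= deg p)%N -> p_sym p c -> p_sym p c' -> c' = c.
Proof.
move=> degp sym sym'; apply/eqP; rewrite -subr_eq0; apply/negPn/negP => d0.
have per x : p.[x + (c' - c)] = p.[x].
  apply: (mulfI eps_neq0).
  rewrite -[x in RHS](subKr c) -(p_symE _ sym) (p_symE (c - x) sym').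
  by congr (_ * _.[_]); ring.
(* Periodicity makes p constant along the multiples of c' - c. Substituting a degree-one polynomial
   preserves the degree, so p itself would be constant. *)
have const : p \Po ((c' - c) *: 'X) = (p.[0])%:P.
  apply: poly_ext_nat => n; rewrite horner_comp !hornerE.
  elim: n => [|n IH]; first by rewrite mulr0.
  by rewrite mulrSr mulrDr mulr1 per.
have := size_polyC_leq1 p.[0]; rewrite -const size_comp_poly2.
  by move: degp; rewrite /deg; case: size => [|[]].
by rewrite size_scale // size_polyX.
Qed.

(** The map a^-1 S is a unital algebra endomorphism of F[x], hence the substitution of the image of
    x. *)
Lemma comp_of_multiplicative (S : {poly F} -> {poly F}) (a : F) :
  linear S -> a != 0 -> S 1 = a%:P ->
  (forall f g, S f * S g = a *: S (f * g)) ->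
  forall f, S f = a *: (f \Po (a^-1 *: S 'X)).
Proof.
move=> lin a0 S1 SM; elim/poly_ind => [|f c IH].
  by rewrite comp_poly0 scaler0 -[0](scale0r 1) (linear_funZ lin) !scale0r.
rewrite (linear_funD lin) -[c%:P]alg_polyC (linear_funZ lin) S1.
rewrite raddfD /= comp_polyM comp_polyX linearZ /= comp_polyC scalerDr; congr (_ + _).
  apply: (scalerI a0); rewrite -SM IH -!scalerAl -scalerAr scalerA.
  by rewrite scalerA mulfK.
by rewrite !scalerA -!mul_polyC -!polyCM mulr1 mulrC.
Qed.

(** Degrees multiply under composition, so T = ax + b; then a^2 = 1, and a = 1 forces 2b = 0. *)
Lemma involutive_comp (T : {poly F}) : T \Po T = 'X ->
  T = 'X \/ exists c, T = c%:P - 'X.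
Proof.
move=> TT; have := size_comp_poly T T; rewrite TT size_polyX => -[] /esym/eqP.
rewrite muln_eq1 andbb => /eqP sz.
have TE : T = T`_1 *: 'X + (T`_0)%:P.
  apply/polyP => i; rewrite !coefE.
  case: i => [|[|i]]; rewrite ?mulr0 ?mulr1 ?add0r ?addr0 //.
  by rewrite nth_default //; move: sz; case: size => //= n ->.
move: T`_1 T`_0 TE => a b TE.
have hT x : a * (a * x + b) + b = x.
  by have := congr1 (horner^~ x) TT; rewrite /= horner_comp TE !hornerE.
have b0 := hT 0; have a1 := hT 1.
have aa : (a - 1) * (a + 1) = 0.
  rewrite (_ : _ * _ = (a * (a * 1 + b) + b) - (a * (a * 0 + b) + b) - 1); last by ring.
  by rewrite a1 b0 subr0 subrr.
move/eqP: aa; rewrite mulf_eq0 subr_eq0 addr_eq0 => /orP[] /eqP ea; last first.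
  by right; exists b; rewrite TE ea scaleN1r addrC.
left; rewrite TE ea scale1r; move: b0; rewrite ea mulr0 add0r mul1r => /eqP.
by rewrite -mulr2n mulrn_eq0 /= => /eqP ->; rewrite addr0.
Qed.

Lemma p_sym_deg0 c : deg p = 0%N -> p_sym p c.
Proof.
move=> degp; have /size1_polyC pC : (size p <= 1)%N.
  by move: degp; rewrite /deg; case: size => [|[]].
by rewrite /p_sym /eps degp expr0 scale1r {2}pC comp_polyC -pC.
Qed.

Lemma shift0 f : shift 0 f = f.
Proof. by rewrite /shift addr0 comp_polyXr. Qed.

(** * Every graded anti-involution is one of the sigma *)

Lemma gai_components s : graded_anti_involution s ->
  exists S : int -> {poly F} -> {poly F},
  [/\ forall k, linear (S k), forall k, involutive (S k),
      forall k l f g, S (k + l) (shift l (f * p) * g) =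
        shift k (S l g * p) * S k f &
      forall k f, s (dap_mon p k f) = dap_mon p k (S k f)].
Proof.
case=> lin inv anti gr.
have /boolp.choice[S0 S0P] : forall kf : int * {poly F}, exists g,
  s (dap_mon p kf.1 kf.2) = dap_mon p kf.1 g.
  by case=> k f; apply: (gr k); exists f.
pose S k f := S0 (k, f); exists S.
have SP k f : s (dap_mon p k f) = dap_mon p k (S k f) by apply: (S0P (k, f)).
have inj := dap_mon_inj p_neq0.
split=> // [k a f g|k f|k l f g].
- by apply: (inj k); rewrite -SP !dap_mon_linear lin !SP.
- by apply: (inj k); rewrite -!SP inv.
by apply: (inj (k + l)); rewrite -SP -dap_mul_mon anti !SP dap_mul_mon addrC.
Qed.

Lemma const_of_mul_eq1 f g : f * g = 1 -> f = (f`_0)%:P.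
Proof.
move=> fg1; apply: size1_polyC.
have : size (f * g) == 1%N by rewrite fg1 size_poly1.
by rewrite size_mul_eq1 => /andP[/eqP ->].
Qed.

Lemma multiplicative_int (b : int -> F) :
  b 0 = 1 -> (forall k l, b (k + l) = b k * b l) -> forall k, b k = b 1 ^ k.
Proof.
move=> b0 bD.
have bn n : b n%:Z = b 1 ^+ n by elim: n => // n IH; rewrite intS bD IH exprS.
case=> n; first by rewrite bn exprnP.
rewrite NegzE -exprnN -bn.
(* The product b(-n-1) b(n+1) = 1 is written as a quotient to read off the inverse. *)
have /divr1_eq : b (- n.+1%:Z) / (b n.+1%:Z)^-1 = 1 by rewrite invrK -bD addNr.
by [].
Qed.

Section Components.
Variable S : int -> {poly F} -> {poly F}.
Hypothesis S_lin : forall k, linear (S k).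
Hypothesis S_inv : forall k, involutive (S k).
Hypothesis S_anti : forall k l f g,
  S (k + l) (shift l (f * p) * g) = shift k (S l g * p) * S k f.

Lemma S_neq0 k : S k 1 != 0.
Proof.
apply/eqP => Sk; have := S_inv k 1; rewrite Sk -[0](scale0r 0).
by rewrite (linear_funZ (S_lin k)) scale0r => /esym/eqP; rewrite oner_eq0.
Qed.

Lemma S0_comp_form : exists a T, [/\ a * a = 1, T \Po T = 'X,
  p = a *: (p \Po T) & forall f, S 0 f = a *: (f \Po T)].
Proof.
have anti f g : S 0 (f * p * g) = S 0 g * p * S 0 f.
  by have := S_anti 0 0 f g; rewrite !shift0.
have mul1 f g : S 0 f * S 0 g = S 0 (f * g) * S 0 1.
  apply: (mulIf p_neq0); rewrite [LHS]mulrAC -anti [RHS]mulrAC -anti.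
  by congr (S 0 _); ring.
pose a := (S 0 1)`_0.
have S1 : S 0 1 = a%:P.
  (* With both arguments S_0(1), involutivity turns the left side into 1, so S_0(1) is a unit of
     F[x]. *)
  have := mul1 (S 0 1) (S 0 1); rewrite S_inv mulr1 mulrC => /esym.
  exact: const_of_mul_eq1.
have a0 : a != 0 by rewrite -polyC_eq0 -S1 S_neq0.
have SM f g : S 0 f * S 0 g = a *: S 0 (f * g).
  by rewrite mul1 S1 mulrC mul_polyC.
have SE := comp_of_multiplicative (S_lin 0) a0 S1 SM.
exists a, (a^-1 *: S 0 'X); have aa : a * a = 1.
  have := S_inv 0 1; rewrite S1 -[a%:P]alg_polyC (linear_funZ (S_lin 0)) S1.
  by rewrite -mul_polyC -polyCM => /polyC_inj.
split=> //.
  (* Writing x as S_0(S_0(x)) gives a S_0(x)(T), and a is its own inverse. *)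
  rewrite {1}comp_polyZ -[RHS](S_inv 0) [in RHS]SE.
  by rewrite (mulr1_eq aa).
(* S_0 fixes p, since S_0(p) = S_0(1) p S_0(1) = a^2 p. *)
have := anti 1 1; rewrite mul1r mulr1 S1 SE mulrC mulrA -polyCM aa mul1r.
by move=> ->.
Qed.

Lemma S0_neq_id : ~ (forall f, S 0 f = f).
Proof.
move=> S0; pose b := S 1 1.
have l f g : S 1 (shift 1 (f * p) * g) = S 1 g * p * f.
  by have := S_anti 0 1 f g; rewrite add0r shift0 S0.
have r f g : S 1 (f * p * g) = shift 1 (g * p) * S 1 f.
  by have := S_anti 1 0 f g; rewrite addr0 shift0 S0.
have sh_neq0 : shift 1 p != 0 by rewrite comp_poly2_eq0 ?size_XaddC.
(* S_1 of p(x) (fp)(x + 1) is computed through both [l] and [r]; the common factors p(x + 1) and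
   S_1(1) cancel. *)
have per f : p * f = shift 1 (shift 1 (f * p)).
  have := r 1 (shift 1 (f * p)); rewrite mul1r mulrC l.
  have := r 1 1; rewrite !mul1r mulr1 => ->.
  rewrite -/b /shift comp_polyM -!/(shift _ _) => e.
  apply: (mulIf sh_neq0); apply: (mulIf (S_neq0 1)); rewrite -/b -e; ring.
(* f = 1 shows that p has period 2; then f = x gives x = x + 2. *)
have p2 := per 1; rewrite mulr1 mul1r in p2.
have := per 'X; rewrite /shift !comp_polyM -!/(shift _ _) -p2 mulrC => /(mulIf p_neq0).
move/(congr1 (horner^~ 0)); rewrite /= !horner_shift !hornerX !add0r => /esym/eqP.
by rewrite -mulr2n mulrn_eq0 oner_eq0.
Qed.

Lemma S0_refl : exists2 c, p_sym p c &
  forall f, S 0 f = eps p *: (f \Po (c%:P - 'X)).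
Proof.
have [a [T [aa TT pT SE]]] := S0_comp_form.
have [TX|[c Tc]] := involutive_comp TT.
  case: S0_neq_id => f; rewrite SE TX comp_polyXr.
  suff -> : a = 1 by rewrite scale1r.
  move: pT; rewrite TX comp_polyXr => /eqP.
  rewrite -{1}[p]scale1r -subr_eq0 -scalerBl scaler_eq0 (negPf p_neq0) orbF.
  by rewrite subr_eq0 => /eqP.
suff ea : a = eps p by exists c; rewrite /p_sym -ea -Tc.
have lp0 : lead_coef p != 0 by rewrite lead_coef_eq0.
have sT : size (c%:P - 'X) = 2 by rewrite -size_polyN opprB size_XsubC.
have lT : lead_coef (c%:P - 'X) = -1.
  by rewrite -[LHS]opprK -lead_coefN opprB lead_coefXsubC.
have /(congr1 lead_coef) := pT.
rewrite Tc lead_coefZ lead_coef_comp ?sT // lT -/(deg p) -/(eps p) mulrCA.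
rewrite -{1}[lead_coef p]mulr1 => /(mulfI lp0)/esym ae.
by apply: (mulIf eps_neq0); rewrite ae eps_sqr.
Qed.

Lemma components_form : exists c u, [/\ p_sym p c, u = 1 \/ u = -1 &
  forall k f, S k f = (eps p * u ^ k) *: (f \Po (- 'X - (k%:~R)%:P + c%:P))].
Proof.
have [c sym S0] := S0_refl; exists c.
have S1 k f : S k f = (f \Po (- 'X - (k%:~R)%:P + c%:P)) * S k 1.
  (* S_k(fp) is computed twice, with p attached to f or to 1; cancelling eps p(x + k) expresses
     S_k(f) through S_k(1). *)
  have h g : S k (g * p) = shift k p * S k g * (eps p)%:P.
    have := S_anti k 0 g 1; rewrite addr0 shift0 mulr1 S0 => ->.
    by apply: poly_ext => x; rewrite !(hornerE, horner_shift, horner_comp); ring.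
  have := S_anti k 0 1 f; rewrite addr0 shift0 mul1r mulrC h S0 => e.
  have sh_neq0 : shift k p * (eps p)%:P != 0.
    by rewrite mulf_neq0 ?polyC_eq0 ?eps_neq0 // comp_poly2_eq0 ?size_XaddC.
  apply: (mulfI sh_neq0); rewrite mulrAC e; apply: poly_ext => x.
  rewrite !(hornerE, horner_shift, horner_comp).
  rewrite (_ : c - (x + k%:~R) = - x - k%:~R + c) /=; ring.
pose b k := (S k 1)`_0.
(* Applying S_k to S_k(1) returns 1 as a multiple of S_k(1), which is thus a unit. *)
have bP k : S k 1 = (b k)%:P.
  have := S_inv k 1; rewrite S1 mulrC; exact: const_of_mul_eq1.
have bb k : b k * b k = 1.
  have := S_inv k 1; rewrite S1 bP comp_polyC -polyCM => /polyC_inj //.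
(* The factor eps absorbs the sign from the symmetry of p, so that [g] is multiplicative. *)
pose g k := eps p * b k.
have g0 : g 0 = 1.
  have := bP 0; rewrite S0 comp_polyC alg_polyC /g => /polyC_inj <-.
  exact: eps_sqr.
have gD k l : g (k + l) = g k * g l.
  rewrite /g mulrACA eps_sqr mul1r.
  have := S_anti k l 1 1; rewrite mul1r mulr1 S1 !bP => e.
  have sh_neq0 : shift k p != 0 by rewrite comp_poly2_eq0 ?size_XaddC.
  apply/polyC_inj/(mulIf sh_neq0); transitivity (shift k ((b l)%:P * p) * (b k)%:P).
    rewrite -e; apply: poly_ext => x.
    rewrite !(hornerE, horner_shift, horner_comp) (p_symE _ sym).
    rewrite (_ : c - _ = - x - (k + l)%:~R + c + l%:~R); last by rewrite intrD; ring.
    by rewrite /= mulrACA eps_sqr mul1r mulrC.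
  by apply: poly_ext => x; rewrite !(hornerE, horner_shift); ring.
exists (g 1); split=> // [|k f].
  have : g 1 ^+ 2 == 1 by rewrite expr2 /g mulrACA eps_sqr bb mulr1.
  by rewrite sqrf_eq1 => /orP[] /eqP; [left | right].
rewrite -multiplicative_int // /g mulrA eps_sqr mul1r S1 bP.
by rewrite mulrC mul_polyC.
Qed.

End Components.

Lemma gai_formula s : graded_anti_involution s ->
  exists c u, [/\ p_sym p c, u = 1 \/ u = -1 & sigma_formula u c s].
Proof.
move=> /gai_components[S [lin inv anti SE]].
have [c [u [sym u1 SP]]] := components_form lin inv anti.
exists c, u; split=> // k f.
by rewrite SE SP (linear_funZ (dap_mon_linear p k)).
Qed.

(** On t p(D) the two maps take opposite nonzero values. *)
Lemma sigma_pm_neq c (sp sm : dap p -> dap p) :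
  sigma_formula 1 c sp -> sigma_formula (-1) c sm -> sp <> sm.
Proof.
move=> spP smP eqs; have := smP 1 1; rewrite -eqs spP !expr1z.
rewrite -!(linear_funZ (dap_mon_linear p 1)) => /(dap_mon_inj p_neq0).
rewrite comp_polyC -!mul_polyC !mulr1 => /polyC_inj/eqP.
by rewrite mulrN1 -addr_eq0 -mulr2n mulrn_eq0 (negPf eps_neq0).
Qed.

Lemma gaiP s : graded_anti_involution s <->
  exists c u, [/\ p_sym p c, u = 1 \/ u = -1, linear s & sigma_formula u c s].
Proof.
split=> [gai|[c [u [sym u1 lin sP]]]].
  by have [c [u [sym u1 sP]]] := gai_formula gai; exists c, u; case: gai.
by apply: (sigma_gai _ sym lin sP); case: u1 => ->; rewrite ?mulrNN mulr1.
Qed.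

End AntiInvolutions.

Theorem theorem2p1 (R : realType) (p : {poly R[i]}) (p_neq0 : p != 0) :
  ((exists s : dap p -> dap p, graded_anti_involution s) <->
   (exists c : R[i], p_sym p c)) /\
  (forall c : R[i], p_sym p c ->
     ((1 <= deg p)%N ->
        (forall c' : R[i], p_sym p c' -> c' = c) /\
        exists sp sm : dap p -> dap p,
          [/\ sigma_formula 1 c sp, sigma_formula (-1) c sm, sp <> sm &
              forall s : dap p -> dap p,
                graded_anti_involution s <-> s = sp \/ s = sm]) /\
     (deg p = 0%N ->
        (forall c' : R[i], p_sym p c') /\
        exists sp sm : R[i] -> dap p -> dap p,
          [/\ forall c', sigma_formula 1 c' (sp c'),
              forall c', sigma_formula (-1) c' (sm c') &
              forall s : dap p -> dap p,
                graded_anti_involution s <->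
                exists c' : R[i], s = sp c' \/ s = sm c'])).
Proof.
have /boolp.choice[sp spP] c := sigma_formula_ex p_neq0 1 c.
have /boolp.choice[sm smP] c := sigma_formula_ex p_neq0 (-1) c.
have gai s : graded_anti_involution s <->
    exists2 c, p_sym p c & s = sp c \/ s = sm c.
  rewrite gaiP //; split=> [[c [u [sym u1 lin sP]]]|[c sym eq_s]]; exists c => //.
    have [[linp spE] [linm smE]] := (spP c, smP c).
    case: u1 sP => -> sP; [left | right].
      exact: eq_sigma lin linp sP spE.
    exact: eq_sigma lin linm sP smE.
  case: eq_s => ->.
    by exists 1; case: (spP c) => ? ?; split=> //; left.
  by exists (-1); case: (smP c) => ? ?; split=> //; right.
split.
  split=> [[s /gai[c sym _]]|[c sym]]; first by exists c.
  by exists (sp c); apply/gai; exists c => //; left.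
move=> c sym; split=> degp; split.
- by move=> c' sym'; apply: p_sym_uniq degp sym sym'.
- exists (sp c), (sm c).
  have [[_ spE] [_ smE]] := (spP c, smP c); split; [exact: spE | exact: smE | |].
    exact: sigma_pm_neq spE smE.
  move=> s; rewrite gai; split=> [[c' sym']|eq_s]; last by exists c.
  (* The c' attached to s must equal c, leaving only the choice of sign. *)
  by rewrite (p_sym_uniq degp sym sym').
- by move=> c'; apply: p_sym_deg0.
- exists sp, sm; split=> [c'|c'|s]; [by case: (spP c') | by case: (smP c') |].
  by rewrite gai; split=> [[c' _ ?]|[c' ?]]; exists c' => //; apply: p_sym_deg0.
Qed.
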